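(* Let $k,r,n\ge 1$ be integers, $p\in(0,1)$, $q=1-p$. Let $\mathrm{NB}_{k,r}$ be a random variable with the negative binomial distribution of Type II, i.e. the waiting time for the $r$-th success run of length at least $k$. Then $$\mathbb{P}(\mathrm{NB}_{k,r}=n)=\sum_{m=r}^{\left\lfloor\frac{n+1}{k+1}\right\rfloor}(-1)^{m-r}\binom{m-1}{r-1}p^{mk}q^{m-1}\left[\binom{n-mk}{m-1}-p\binom{n-mk-1}{m-1}\right].$$
   Context: Consider independent Bernoulli trials, indexed $1,2,3,\dots$, each with success probability $p$. In Type II counting, a success run is a maximal block of consecutive successes, so distinct runs are separated by at least one failure. $\mathrm{NB}_{k,r}$ is the index of the first trial $n$ such that the first $n$ trials contain $r$ success runs of length at least $k$ (that is, the trial at which the $r$-th such run first attains length $k$). Conventions: $\binom{a}{b}=0$ unless $0\le b\le a$ (in particular $\binom{-1}{0}=0$), and an empty sum is $0$. (Muselli's known formula for the same probability has the bracket $\binom{n-mk-1}{m-2}+q\binom{n-mk-1}{m-1}$ in place of the bracket above.) *)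

(* Defs.v *)
From HB Require Import structures.
From mathcomp Require Import all_boot all_order all_algebra.
From mathcomp Require Import finmap.
From mathcomp Require Import all_classical all_reals all_analysis.

Set Implicit Arguments.
Unset Strict Implicit.
Unset Printing Implicit Defensive.

Import Order.TTheory GRing.Theory Num.Theory.

Local Open Scope classical_set_scope.
Local Open Scope ring_scope.

(* Positions in [s] are numbered from 0; the block consists of the positions
   [i <= l < j].  The default value [false] makes the end of [s] a boundary. *)
Definition success_run (s : seq bool) (i j : nat) : bool :=
  [&& (i < j <= size s)%N,
      all (nth false s) (index_iota i j),
      (i == 0%N) || ~~ nth false s i.-1
    & ~~ nth false s j].

Definition num_long_runs (k : nat) (s : seq bool) : nat :=
  #|[pred ij : 'I_(size s).+1 * 'I_(size s).+1
      | success_run s ij.1 ij.2 && (k <= ij.2 - ij.1)%N]|.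

(* Trials are numbered from 1, so [x 0] is never inspected. *)
Definition first_trials (x : nat -> bool) (n : nat) : seq bool :=
  [seq x i | i <- iota 1 n].

Definition enough_runs (k r : nat) (x : nat -> bool) (n : nat) : bool :=
  (0 < n)%N && (r <= num_long_runs k (first_trials x n))%N.

(* [None] stands for an infinite waiting time. *)
Definition waiting_time (k r : nat) (x : nat -> bool) : option nat :=
  match pselect (exists n, enough_runs k r x n) with
  | left ex_n => Some (ex_minn ex_n)
  | right _ => None
  end.

Definition NB (d : measure_display) (T : measurableType d) (R : realType)
    (P : probability T R) (X : nat -> {RV P >-> bool}) (k r : nat) (t : T) :
    option nat :=
  waiting_time k r (fun i => X i t).

Definition mutually_independent (d d' : measure_display)
    (T : measurableType d) (T' : measurableType d') (R : realType)
    (P : probability T R) (I : choiceType) (A : set I)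
    (X : I -> {RV P >-> T'}) : Prop :=
  forall J : {fset I}, [set` J] `<=` A ->
  forall B : I -> set T', (forall i, i \in J -> measurable (B i)) ->
    P (\bigcap_(i in [set` J]) (X i @^-1` B i)) =
    (\prod_(i <- J) P (X i @^-1` B i))%E.

Definition bernoulli_trials (d : measure_display) (T : measurableType d)
    (R : realType) (P : probability T R) (p : R)
    (X : nat -> {RV P >-> bool}) : Prop :=
  (forall i, (0 < i)%N -> P (X i @^-1` [set true]) = p%:E) /\
  mutually_independent [set i : nat | (0 < i)%N] X.

(* Unlike ['C(a, b)] on truncated differences, this is 0 as soon as [a < 0];
   in particular [binz (-1) 0 = 0], whereas ['C(n - n.+1, 0) = 1]. *)
Definition binz (a b : int) : nat :=
  if (0 <= b) && (b <= a) then 'C(`|a|%N, `|b|%N) else 0%N.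

(* Main.v *)
Require Import Defs.
From HB Require Import structures.
From mathcomp Require Import all_boot all_order all_algebra.
From mathcomp Require Import finmap.
From mathcomp Require Import all_classical all_reals all_analysis.
From mathcomp Require Import zify ring.

Import Order.TTheory GRing.Theory Num.Theory.

Local Open Scope classical_set_scope.
Local Open Scope ring_scope.

(** Call a completion any trial at which some success run attains length
    exactly [k].  The waiting time is [n] if and only if the [n]-th trial is a
    completion and exactly [r - 1] completions precede it ([waiting_timeP]).
    Binomial inversion ([binomial_inversion]) writes the indicator of
    [c = r - 1] as the alternating sum over [m] of
    [(-1)^(m - r) 'C(m - 1, r - 1) 'C(c, m - 1)], so the probability sought is
    the same alternating combination of the [g_(m-1)(n)], where
    [g_m(n) = E (1_(n is a completion) * 'C(completions before n, m))].

    These moments satisfy a closed system together with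
    [h_m(n) = E 'C(completions up to n, m)].  Pascal's rule gives
    [h_(m+1)(n+1) = h_(m+1)(n) + g_m(n+1)] ([run_momentS]).  A completion at
    [n > k] means that the last [k] trials are successes and the one before
    them is a failure; that window contains no earlier completion and is
    independent of what precedes it, whence
    [g_m(n) = p^k q h_m(n - k - 1)] ([completion_momentE]).  Induction on [m],
    with Pascal's rule once more, yields
    [g_m(n) = p^((m+1)k) q^m ('C(n-(m+1)k, m) - p 'C(n-(m+1)k-1, m))]
    ([completion_moment_closed]).

    Outcomes are kept as lists with the latest trial first, so that all
    recursions in time are structural, and [expect] is the expectation of a
    function of such a list under independent Bernoulli trials.  Two bridges
    connect this to the probability space: [num_long_runs_rev], which counts
    runs by their completions instead of by their endpoints, and
    [history_prob], where independence is used. *)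

(** * Runs of a list of outcomes *)

Definition leading_run (s : seq bool) : nat := find negb s.

(** Each suffix is the history up to some trial, and its leading run has length
    exactly [k] when that trial is a completion. *)
Fixpoint completions (k : nat) (s : seq bool) : nat :=
  if s is _ :: s' then (completions k s' + (leading_run s == k))%N else 0%N.

Lemma leading_run_eqE (k : nat) (s : seq bool) :
  (leading_run s == k) = all (nth false s) (iota 0 k) && ~~ nth false s k.
Proof.
elim: s k => [|[] s IHs] [|k] //=.
  by rewrite eqSS IHs -[1%N]addn1 addnC iotaDl all_map.
Qed.

(** A run of length at least [k] begins at [i].  As [nth] defaults to a failure,
    this forces [i + k <= size s] when [0 < k]. *)
Definition long_start (k : nat) (s : seq bool) (i : nat) : bool :=
  all (nth false s) (iota i k) && ((i == 0%N) || ~~ nth false s i.-1).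

Lemma long_start_oversize k s i : (0 < k)%N -> (size s < i + k)%N ->
  long_start k s i = false.
Proof.
move=> k0 sik; apply/negP => /andP[/allP /(_ (i + k).-1)].
rewrite mem_iota nth_default; last by lia.
by move=> /(_ ltac:(lia)).
Qed.

Lemma success_run_end s i j :
  success_run s i j -> j = (i + leading_run (drop i s))%N.
Proof.
case/and4P => ij /allP run _ fin.
suff /eqP -> : leading_run (drop i s) == (j - i)%N by lia.
rewrite leading_run_eqE nth_drop subnKC ?fin ?andbT; last by lia.
apply/allP => l; rewrite mem_iota nth_drop => lj; apply: run.
by rewrite mem_index_iota; lia.
Qed.

Lemma long_startP k s i : (0 < k)%N -> (i <= size s)%N ->
  long_start k s i =
  success_run s i (i + leading_run (drop i s)) && (k <= leading_run (drop i s))%N.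
Proof.
move=> k0 ile; have := eqxx (leading_run (drop i s)).
rewrite {1}leading_run_eqE => /andP[/allP run fin].
have szl : (leading_run (drop i s) <= size s - i)%N by rewrite -size_drop find_size.
apply/andP/andP => [[/allP sk bd]|[/and4P[ij /allP run' bd _] kl]].
  have kl : (k <= leading_run (drop i s))%N.
    rewrite leqNgt; apply/negP => lk; move: fin; rewrite nth_drop.
    by rewrite sk // mem_iota; lia.
  split => //; apply/and4P; split => //; first by lia.
    apply/allP => l; rewrite mem_index_iota => /andP[il lj].
    have := run (l - i)%N; rewrite nth_drop subnKC //; apply.
    by rewrite mem_iota; lia.
  by rewrite -nth_drop.
split=> //; apply/allP => l; rewrite mem_iota => lk; apply: run'.
by rewrite mem_index_iota; lia.
Qed.

(** A maximal run is determined by its starting point, so counting pairs of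
    endpoints amounts to counting starting points. *)
Lemma num_long_runs_starts k s : (0 < k)%N ->
  num_long_runs k s = (\sum_(0 <= i < (size s).+1) long_start k s i)%N.
Proof.
move=> k0; rewrite big_mkord /num_long_runs -sum1_card [LHS]big_mkcond /=.
rewrite -(pair_bigA _ (fun i j : 'I_(size s).+1 =>
  if success_run s i j && (k <= j - i)%N then 1%N else 0%N)) /=.
apply: eq_bigr => i _.
have ile : (i <= size s)%N by rewrite -ltnS.
have [|nst] := boolP (long_start k s i).
  rewrite long_startP // => /andP[run kl].
  have lt : (i + leading_run (drop i s) < (size s).+1)%N by case/and4P: run; lia.
  rewrite (bigD1 (Ordinal lt)) //= run addKn kl big1 // => j /eqP ne.
  case: ifP => // /andP[/success_run_end jE _]; case: ne.
  exact: val_inj.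
rewrite big1 // => j _; case: ifP => // /andP[run kl]; case/negP: nst.
have jE := success_run_end _ _ _ run.
by rewrite long_startP // -jE run; lia.
Qed.

(** One more trial creates a long run only at the start [i] for which
    [i + k] is the new length, and does so exactly when it is a completion. *)
Lemma long_start_rcons k s b i : (0 < k)%N ->
  long_start k (rcons s b) i =
  (long_start k s i +
   (i + k == (size s).+1) * (leading_run (b :: rev s) == k))%N :> nat.
Proof.
move=> k0; have [ik|ik|ik] := ltngtP (i + k)%N (size s).+1.
- rewrite mul0n addn0; congr (nat_of_bool _); congr andb.
    apply: eq_in_all => l; rewrite mem_iota nth_rcons => /andP[_ lk].
    by have -> : (l < size s)%N by lia.
  by case: i ik => //= i ik; rewrite nth_rcons; have -> : (i < size s)%N by lia.
- by rewrite !long_start_oversize // ?size_rcons; lia.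
- rewrite mul1n (long_start_oversize k s) ?add0n; [|lia|lia].
  congr (nat_of_bool _).
  rewrite leading_run_eqE -rev_rcons; congr andb.
    apply/allP/allP => run l; rewrite mem_iota => lk.
      rewrite nth_rev ?size_rcons; last by lia.
      by apply: run; rewrite mem_iota; lia.
    have := run ((size s) - l)%N; rewrite nth_rev ?size_rcons; last by lia.
    have -> : ((size s).+1 - (size s - l).+1)%N = l by lia.
    by apply; rewrite mem_iota; lia.
  case: i ik => [|i] ik; first by rewrite [in RHS]nth_default ?size_rev ?size_rcons //; lia.
  rewrite nth_rev ?size_rcons /=; last by lia.
  by have -> : ((size s).+1 - k.+1)%N = i by lia.
Qed.

(** The long runs are in bijection with the completions: a run that starts at
    [i] is completed after [i + k] trials, however long it grows afterwards. *)
Lemma num_long_runs_rev k s : (0 < k)%N -> num_long_runs k (rev s) = completions k s.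
Proof.
move=> k0; elim: s => [|b s IHs].
  by rewrite num_long_runs_starts // big_nat1 long_start_oversize.
rewrite /= -IHs !num_long_runs_starts // rev_cons size_rcons.
under eq_bigr do rewrite long_start_rcons // revK.
rewrite big_split big_nat_recr //= [long_start _ _ _.+1]long_start_oversize ?addn0; [|lia..].
congr addn; rewrite size_rev -big_distrl /=.
have [lk|] := eqVneq; last by rewrite muln0.
have ks : (k <= (size s).+1)%N.
  by rewrite -lk; exact: (find_size negb (b :: s)).
rewrite muln1 big_mkord.
have i0 : ((size s).+1 - k < (size s).+2)%N by lia.
rewrite (bigD1 (Ordinal i0)) //= subnK // eqxx big1 // => i /eqP ne.
have [e|//] := eqVneq; case: ne; apply: val_inj => /=; lia.
Qed.

Lemma completions_le_size k s : (completions k s <= size s)%N.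
Proof. by elim: s => //= b s; case: eqP; lia. Qed.

(** A failure followed by fewer than [k] successes contains no completion. *)
Lemma completions_nseq_cat j k s : (j < k)%N ->
  completions k (nseq j true ++ false :: s) = completions k s.
Proof.
elim: j => [|j IHj] jk /=; first by rewrite /leading_run /=; lia.
have e : leading_run (nseq j true ++ false :: s) = j.
  by rewrite /leading_run; elim: (j) => //= i ->.
rewrite IHj; last by lia.
by move: e; rewrite /leading_run /= => ->; lia.
Qed.

Lemma completions_nseq j k : (j < k)%N -> completions k (nseq j true) = 0%N.
Proof.
elim: j => [//|j IHj] jk.
have e : leading_run (nseq j true) = j by rewrite /leading_run; elim: (j) => //= i ->.
rewrite /= IHj; last by lia.
by move: e; rewrite /leading_run /= => ->; lia.
Qed.

(** * The coefficients [binz] *)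

Lemma binz_neg a b : (a < b)%R -> binz a b = 0%N.
Proof. by move=> ab; rewrite /binz (leNgt b) ab andbF. Qed.

Lemma binz0 a : binz a 0 = (0 <= a).
Proof. by rewrite /binz lexx /=; case: ifP => // _; rewrite bin0. Qed.

Lemma binz_nat (a b : nat) : binz a b = 'C(a, b).
Proof. by rewrite /binz lez_nat /=; case: leqP => // ab; rewrite bin_small. Qed.

(** Pascal's rule survives for all integers [a] because the lower index is
    positive: at [a = -1] it reads [0 = 0 + 0], whereas with lower index [0]
    the jump from [binz (-1) 0 = 0] to [binz 0 0 = 1] would break it. *)
Lemma binzS (a : int) (m : nat) :
  binz (a + 1) m.+1%:Z = (binz a m.+1%:Z + binz a m%:Z)%N.
Proof.
case: a => a.
  rewrite -PoszD addn1.
  by rewrite !binz_nat binS.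
by rewrite !binz_neg //; lia.
Qed.

(** * Moments of the number of completions *)

Section Expectation.
Context {R : comNzRingType} (p : R).

Fixpoint expect (n : nat) (F : seq bool -> R) : R :=
  if n is n'.+1 then
    p * expect n' (fun s => F (true :: s))
    + (1 - p) * expect n' (fun s => F (false :: s))
  else F [::].

Lemma eq_expect n F G : (forall s, size s = n -> F s = G s) ->
  expect n F = expect n G.
Proof.
elim: n F G => [|n IHn] F G FG /=; first exact: FG.
by congr (_ * _ + _ * _); apply: IHn => s sn; apply: FG; rewrite /= sn.
Qed.

Lemma expectD n F G :
  expect n (fun s => F s + G s) = expect n F + expect n G.
Proof. by elim: n F G => //= n IHn F G; rewrite !IHn; ring. Qed.

Lemma expectZ n a F : expect n (fun s => a * F s) = a * expect n F.
Proof. by elim: n F => //= n IHn F; rewrite !IHn; ring. Qed.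

Lemma expect_cst n a : expect n (fun=> a) = a.
Proof. by elim: n => //= n ->; ring. Qed.

Lemma expect_sum n (I : Type) (l : seq I) (F : I -> seq bool -> R) :
  expect n (fun s => \sum_(i <- l) F i s) = \sum_(i <- l) expect n (F i).
Proof.
elim: l => [|i l IHl].
  by rewrite big_nil -[RHS](expect_cst n); apply: eq_expect => s _; rewrite big_nil.
rewrite big_cons -IHl -expectD; apply: eq_expect => s _; exact: big_cons.
Qed.

(** The renewal step: the leading run has length exactly [k] if and only if the
    list is [k] successes, either alone or followed by a failure and an
    arbitrary, independent, remainder. *)
Lemma expect_leading_run n k F :
  expect n (fun s => (leading_run s == k)%:R * F s) =
  if (n < k)%N then 0 else
  if n == k then p ^+ k * F (nseq k true) else
  p ^+ k * (1 - p) * expect (n - k.+1) (fun s => F (nseq k true ++ false :: s)).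
Proof.
elim: k n F => [|k IHk] [|n] F /=.
- by rewrite expr0.
- rewrite subn1 expr0 /=.
  under [X in p * X]eq_expect do rewrite mul0r.
  rewrite expect_cst mulr0 add0r mul1r; congr (_ * _).
  by apply: eq_expect => s _; rewrite mul1r.
- by rewrite mul0r.
- under [X in _ + _ * X]eq_expect do rewrite mul0r.
  rewrite expect_cst mulr0 addr0 /=.
  under eq_expect do rewrite eqSS.
  rewrite (IHk n (fun s => F (true :: s))) ltnS eqSS subSS.
  by case: ifP => _; [rewrite mulr0|case: ifP => _; rewrite exprS; ring].
Qed.

(** Binomial moments are used rather than powers because the increment of
    ['C(c, m.+1)] when [c] grows by one is ['C(c, m)]. *)
Definition run_moment k m n := expect n (fun s => ('C(completions k s, m))%:R).

(** [behead] discards the current trial, so only earlier completions count. *)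
Definition completion_moment k m n :=
  expect n (fun s => (leading_run s == k)%:R * ('C(completions k (behead s), m))%:R).

Lemma run_moment0 k n : run_moment k 0 n = 1.
Proof. by rewrite -[RHS](expect_cst n); apply: eq_expect => s _; rewrite bin0. Qed.

Lemma run_momentS k m n :
  run_moment k m.+1 n.+1 = run_moment k m.+1 n + completion_moment k m n.+1.
Proof.
rewrite {1}/run_moment.
transitivity (expect n.+1 (fun s => ('C(completions k (behead s), m.+1))%:R
   + (leading_run s == k)%:R * ('C(completions k (behead s), m))%:R)).
  apply: eq_expect => -[//|b s] _ /=; case: eqP => _.
    by rewrite addn1 binS natrD mul1r.
  by rewrite addn0 mul0r addr0.
by rewrite expectD; congr (_ + _); rewrite /= -mulrDl addrC subrK mul1r.
Qed.

(** The [k - 1] successes that remain once the current trial is discarded,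
    preceded by a failure, are too few for a completion: all earlier completions
    lie in the remainder. *)
Lemma completion_momentE k m n : (0 < k)%N ->
  completion_moment k m n = if (n < k)%N then 0 else
    if n == k then p ^+ k * (m == 0%N)%:R else
    p ^+ k * (1 - p) * run_moment k m (n - k.+1).
Proof.
case: k => // k _; rewrite /completion_moment expect_leading_run; do 2 case: ifP => _ //.
  by rewrite /= completions_nseq // bin0n.
congr (_ * _); apply: eq_expect => s _ /=.
by rewrite completions_nseq_cat.
Qed.

Definition bracket k m (n : int) : R :=
  (binz (n - (m * k)%:Z) (m%:Z - 1))%:R
  - p * (binz (n - (m * k)%:Z - 1) (m%:Z - 1))%:R.

(** Summing the increments [g_m] telescopes: by Pascal's rule, the difference
    in [n] of the right-hand side is the closed form of [g_m]. *)
Lemma run_moment_closed k m : (0 < k)%N ->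
  (forall n, completion_moment k m n =
    p ^+ (m.+1 * k) * (1 - p) ^+ m * bracket k m.+1 n) ->
  forall n, run_moment k m.+1 n =
    p ^+ (m.+1 * k) * (1 - p) ^+ m *
    ((binz (n%:Z - (m.+1 * k)%:Z + 1) m.+1)%:R
     - p * (binz (n%:Z - (m.+1 * k)%:Z) m.+1)%:R).
Proof.
move=> k0 gE; elim=> [|n IHn].
  by rewrite /run_moment [LHS]/= bin0n mulr0n !binz_neg; [ring|lia|lia].
rewrite run_momentS IHn gE /bracket.
have -> : m.+1%:Z - 1 = m by lia.
set a := n%:Z - _.
have -> : n.+1%:Z - (m.+1 * k)%:Z = a + 1 by rewrite /a; lia.
rewrite addrK !binzS !natrD; ring.
Qed.

Lemma completion_moment_closed k m n : (0 < k)%N ->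
  completion_moment k m n = p ^+ (m.+1 * k) * (1 - p) ^+ m * bracket k m.+1 n.
Proof.
move=> k0; elim: m n => [|m IHm] n; rewrite completion_momentE // /bracket.
  rewrite mul1n subrr !binz0 expr0 run_moment0.
  have [nk|nk|->] := ltngtP n k.
  - have -> : (0 <= n%:Z - k%:Z) = false by lia.
    have -> : (0 <= n%:Z - k%:Z - 1) = false by lia.
    by rewrite /=; ring.
  - have -> : (0 <= n%:Z - k%:Z) = true by lia.
    have -> : (0 <= n%:Z - k%:Z - 1) = true by lia.
    by rewrite /=; ring.
  - by rewrite subrr /=; ring.
have [nk|nk|->] := ltngtP n k.
- by rewrite !binz_neg; [ring|lia|lia].
- rewrite (run_moment_closed k m k0 IHm).
  have -> : (n - k.+1)%:Z - (m.+1 * k)%:Z = n%:Z - (m.+2 * k)%:Z - 1 by lia.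
  have -> : m.+2%:Z - 1 = m.+1 by lia.
  by rewrite subrK (mulSn m.+1 k) exprD [in RHS]exprS; ring.
- by rewrite !binz_neg /=; [ring|lia|lia].
Qed.

(** [m] completions within [n] trials need [m] blocks of [k] successes and
    [m - 1] separating failures; this is the upper limit of the sum. *)
Lemma bracket_eq0 k m n : (0 < m)%N -> (n.+1 < m * k.+1)%N -> bracket k m n = 0.
Proof. by move=> m0 nm; rewrite /bracket !binz_neg; [ring|lia|lia]. Qed.

(** Induction on [c]: Pascal's rule in ['C(c, m)] and then in ['C(m, j)] shows
    that the sum is unchanged when [c] and [j] both decrease by one, and
    vanishes for [j = 0 < c].  The sign exponent is [m + j], which has the
    parity of [m - j] but involves no truncated subtraction. *)
Lemma binomial_inversion (c j N : nat) : (c < N)%N ->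
  \sum_(0 <= m < N) (-1) ^+ (m + j) * ('C(m, j))%:R * ('C(c, m))%:R
   = (c == j)%:R :> R.
Proof.
have shift c' j' N' : (c' < N')%N ->
    \sum_(0 <= m < N'.+1) (-1) ^+ (m + j') * ('C(m, j'))%:R * ('C(c'.+1, m))%:R
    = \sum_(0 <= m < N') (-1) ^+ (m + j') * ('C(m, j'))%:R * ('C(c', m))%:R
    - \sum_(0 <= m < N') (-1) ^+ (m + j') * ('C(m.+1, j'))%:R * ('C(c', m))%:R :> R.
  move=> cN; rewrite big_nat_recl //=.
  under eq_bigr => m _ do rewrite binS natrD mulrDr.
  rewrite big_split /= addrA; congr (_ + _).
    transitivity (\sum_(0 <= m < N'.+1)
       (-1) ^+ (m + j') * ('C(m, j'))%:R * ('C(c', m))%:R : R).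
      by rewrite [RHS]big_nat_recl // !bin0.
    by rewrite big_nat_recr //= [X in _ * X%:R]bin_small // mulr0 addr0.
  by rewrite -sumrN; apply: eq_bigr => m _; rewrite addSn exprS; ring.
elim: c j N => [|c IHc] j [|N] // cN.
  rewrite big_nat_recl //= big1 => [|m _]; last by rewrite mulr0.
  by rewrite bin0 bin0n; case: j => [|j] /=; rewrite ?expr0; ring.
rewrite shift //; case: j => [|j].
  by under [X in _ - X]eq_bigr => m _ do rewrite bin0 -(bin0 m); rewrite subrr.
under [X in _ - X]eq_bigr => m _ do rewrite binS natrD mulrDr mulrDl.
rewrite big_split /= opprD addrA subrr add0r eqSS -(IHc j N) //.
by rewrite -sumrN; apply: eq_bigr => m _; rewrite addnS exprS; ring.
Qed.

End Expectation.

(** * The waiting time in terms of completions *)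

Definition history (x : nat -> bool) (n : nat) : seq bool :=
  rev (first_trials x n).

Lemma historyS x n : history x n.+1 = x n.+1 :: history x n.
Proof.
rewrite /history /first_trials -[in LHS](addn1 n) iotaD map_cat rev_cat /=.
by rewrite add1n.
Qed.

Lemma enough_runsE k r x n : (0 < k)%N -> (0 < r)%N ->
  enough_runs k r x n = (r <= completions k (history x n))%N.
Proof.
move=> k0 r0; rewrite /enough_runs -num_long_runs_rev // /history revK.
case: n => [|n] //=; rewrite -[first_trials x 0]revK num_long_runs_rev //=.
by case: r r0.
Qed.

Lemma completions_history_mono k x m n : (m <= n)%N ->
  (completions k (history x m) <= completions k (history x n))%N.
Proof.
move=> /subnK <-; elim: (n - m)%N => // i IHi.
by rewrite addSn historyS (leq_trans IHi) //= leq_addr.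
Qed.

(** The count is nondecreasing and grows by at most one per trial, so it reaches
    [r] for the first time at [n] exactly when [n] is a completion preceded by
    [r - 1] others. *)
Lemma waiting_timeP k r x n : (0 < k)%N -> (0 < r)%N ->
  waiting_time k r x = Some n <->
  (leading_run (history x n) == k) && (completions k (behead (history x n)) == r.-1).
Proof.
move=> k0 r0; rewrite /waiting_time; case: pselect => [ex|nex]; last first.
  split=> // /andP[lk rk]; case: nex; exists n.
  case: n lk rk => [|n]; first by rewrite [leading_run _]/=; lia.
  by rewrite enough_runsE // historyS /= => -> /eqP ->; lia.
case: ex_minnP => m; rewrite enough_runsE // => rm mmin.
split=> [[mn]|].
  rewrite -{}mn; case: m rm mmin => [|m] rm mmin.
    by move: rm; rewrite /= leqNgt r0.
  have : ~~ (r <= completions k (history x m))%N.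
    by apply/negP => rm'; have := mmin m; rewrite enough_runsE // => /(_ rm'); lia.
  by move: rm; rewrite historyS /=; case: eqP => _; lia.
case: n => [|n]; first by rewrite [leading_run _]/=; lia.
rewrite historyS /= => /andP[lk /eqP rk].
have := mmin n.+1; rewrite enough_runsE // historyS /= lk rk => /(_ ltac:(lia)) mn.
have [->//|mn'] := eqVneq m n.+1.
have := @completions_history_mono k x m n; lia.
Qed.

(** * The law of the history *)

Section Law.
Context {d : measure_display} {T : measurableType d} {R : realType}.
Context (P : probability T R) (p : R) (X : nat -> {RV P >-> bool}).

(** The event depends on finitely many binary variables: split on each in turn. *)
Lemma measurable_trials (l : seq nat) (F : pred (seq bool)) :
  measurable [set t | F [seq X i t | i <- l]].
Proof.
elim: l F => [|i l IHl] F /=.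
  by case: (F [::]); [rewrite set_true|rewrite set_false].
have -> : [set t | F (X i t :: [seq X j t | j <- l])] =
    (X i @^-1` [set true] `&` [set t | F (true :: [seq X j t | j <- l])]) `|`
    (X i @^-1` [set false] `&` [set t | F (false :: [seq X j t | j <- l])]).
  apply/seteqP; split=> t /=; last by case=> -[->].
  by case: (X i t) => ?; [left|right].
by apply: measurableU; apply: measurableI;
  by [apply: measurable_funPTI|apply: (IHl (fun s => F (_ :: s)))].
Qed.

Definition weight (b : bool) : R := if b then p else 1 - p.

Lemma trial_prob i b : bernoulli_trials p X -> (0 < i)%N ->
  P (X i @^-1` [set b]) = (weight b)%:E.
Proof.
move=> hX i0; case: b; first exact: hX.1.
have -> : X i @^-1` [set false] = ~` (X i @^-1` [set true]).
  by apply/seteqP; split=> t /=; case: (X i t).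
by rewrite probability_setC ?hX.1 //; exact: measurable_funPTI.
Qed.

(** The only place where independence enters, for the index set [1, ..., size w]. *)
Lemma trials_prob (w : seq bool) :
  bernoulli_trials p X ->
  P [set t | [seq X i t | i <- iota 1 (size w)] == w] =
  (\prod_(b <- w) weight b)%:E.
Proof.
move=> hX; pose J : {fset nat} := [fset i in iota 1 (size w)]%fset.
have JE i : (i \in J) = (0 < i <= size w)%N.
  by rewrite !inE mem_iota; lia.
have := hX.2 J _ (fun i => [set nth false w i.-1]) (fun _ _ => I).
have -> : [set t | [seq X i t | i <- iota 1 (size w)] == w] =
  \bigcap_(i in [set` J]) (X i @^-1` [set nth false w i.-1]).
  apply/seteqP; split=> t /=.
    move=> /eqP wE i /=; rewrite JE => iw; rewrite -wE.
    rewrite (nth_map 0%N) ?size_iota ?nth_iota; [|lia..].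
    by congr (X _ t); lia.
  move=> h; apply/eqP/(@eq_from_nth _ false); first by rewrite size_map size_iota.
  rewrite size_map size_iota => i iw.
  rewrite (nth_map 0%N) ?size_iota ?nth_iota // add1n.
  by rewrite (h i.+1) //= JE; lia.
move=> ->; last by move=> i /=; rewrite JE => /andP[].
rewrite (perm_big (iota 1 (size w))) /=; last first.
  apply: uniq_perm; [exact: fset_uniq|exact: iota_uniq|].
  by move=> i; rewrite -[LHS]/(i \in J) !inE.
rewrite (iotaDl 1 0) big_map -prodEFin (big_nth false) /index_iota subn0.
by apply: eq_bigr => i _; rewrite trial_prob.
Qed.

(** The pattern [w] of the trials after [n] makes the induction go through:
    splitting on the outcome of trial [n + 1] moves it from the history to the
    front of the pattern, until no history is left. *)
Lemma history_trials_prob n (F : pred (seq bool)) (w : seq bool) :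
  bernoulli_trials p X ->
  P [set t | F (history (X ^~ t) n) &&
             ([seq X i t | i <- iota n.+1 (size w)] == w)] =
  (expect p n (fun s => (F s)%:R) * \prod_(b <- w) weight b)%:E.
Proof.
move=> hX; elim: n F w => [|n IHn] F w /=.
  case: (F _) => /=; first by rewrite mul1r trials_prob.
  by rewrite mul0r set_false measure0.
pose A b := [set t | F (b :: history (X ^~ t) n) &&
             ([seq X i t | i <- iota n.+1 (size (b :: w))] == b :: w)].
have mA b : measurable (A b).
  have := measurable_trials (iota 1 (n + size (b :: w)))
    (fun s => F (b :: rev (take n s)) && (drop n s == b :: w)).
  congr measurable; apply/seteqP; split=> t /=;
  by rewrite iotaD map_cat take_size_cat ?drop_size_cat ?size_map ?size_iota // add1n.
have -> : [set t | F (history (X ^~ t) n.+1) &&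
    ([seq X i t | i <- iota n.+2 (size w)] == w)] = A true `|` A false.
  apply/seteqP; split=> t /=; rewrite historyS /A /= !eqseq_cons.
    by case: (X n.+1 t); [left|right].
  by case; case: (X n.+1 t); rewrite /= ?andbF.
transitivity (P (A true) + P (A false))%E.
  apply: measureU => //; apply/seteqP; split=> t //; rewrite /A /= !eqseq_cons.
  by case: (X n.+1 t) => -[]; rewrite /= ?andbF.
have PA b : P (A b) =
    (expect p n (fun s => (F (b :: s))%:R) * \prod_(c <- b :: w) weight c)%:E.
  exact: (IHn (fun s => F (b :: s)) (b :: w)).
rewrite !PA -EFinD.
by rewrite !big_cons /=; congr EFin; ring.
Qed.

Lemma history_prob n (F : pred (seq bool)) :
  bernoulli_trials p X ->
  P [set t | F (history (X ^~ t) n)] = (expect p n (fun s => (F s)%:R))%:E.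
Proof.
move=> hX; have := history_trials_prob n F [::] hX; rewrite big_nil mulr1 => <-.
by congr (P _); apply/seteqP; split=> t /=; rewrite andbT.
Qed.

End Law.

(** * The probability mass function *)

Theorem mainTheorem12 (d : measure_display) (T : measurableType d)
    (R : realType) (P : probability T R) (p q : R)
    (X : nat -> {RV P >-> bool}) (k r n : nat)
    (hk : (1 <= k)%N) (hr : (1 <= r)%N) (hn : (1 <= n)%N)
    (hp0 : 0 < p) (hp1 : p < 1) (hq : q = 1 - p)
    (hX : bernoulli_trials p X) :
  P [set t | NB X k r t = Some n] =
  (\sum_(r <= m < ((n + 1) %/ (k + 1)).+1)
      (-1) ^+ (m - r) * (binz (m%:Z - 1) (r%:Z - 1))%:R
      * p ^+ (m * k) * q ^+ (m - 1)
      * ((binz (n%:Z - (m * k)%:Z) (m%:Z - 1))%:R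
         - p * (binz (n%:Z - (m * k)%:Z - 1) (m%:Z - 1))%:R))%:E.
Proof.
pose F s := (leading_run s == k) && (completions k (behead s) == r.-1).
have -> : [set t | NB X k r t = Some n] = [set t | F (history (X ^~ t) n)].
  by apply/seteqP; split=> t; apply waiting_timeP.
rewrite (history_prob P p X _ _ hX); congr EFin.
pose c m : R := (-1) ^+ (m + r.-1) * ('C(m, r.-1))%:R.
transitivity (\sum_(0 <= m < n.+1) c m * completion_moment p k m n).
  rewrite /completion_moment; under [RHS]eq_bigr do rewrite -expectZ.
  rewrite -expect_sum; apply: eq_expect => s sn.
  rewrite /F -mulnb natrM -(binomial_inversion (completions k (behead s)) _ n.+1); last first.
    by rewrite ltnS (leq_trans (completions_le_size _ _)) // size_behead; lia.
  by rewrite mulr_sumr; apply: eq_bigr => m _; rewrite /c; ring.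
pose G m : R := c m.-1 * (p ^+ (m * k) * q ^+ m.-1 * bracket p k m n).
(* The index of the statement counts the completion at [n] as well, hence the
   shift by one. *)
transitivity (\sum_(1 <= m < n.+2) G m).
  rewrite (big_add1 _ _ 0%N n.+2) /=; apply: eq_bigr => m _.
  by rewrite /G /= completion_moment_closed // hq.
(* The range of [m] is extended at both ends to [1 <= m < n + 2]: the extra terms vanish,
   below [r] by ['C(m - 1, r - 1)] and above by [bracket_eq0]. *)
rewrite [RHS](big_nat_widenl r 1) // [RHS](big_nat_widen _ _ n.+2); last first.
  by rewrite ltnS addn1 leq_div.
rewrite [RHS]big_mkcond; apply: eq_big_nat => m /andP[m0 _].
rewrite /G /c; have [rm|mr] /= := leqP r m; last first.
  by rewrite bin_small ?mulr0 ?mul0r //; lia.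
rewrite ltnS; case: leqP => [_|mM]; last first.
  by rewrite bracket_eq0 ?mulr0 //; move: mM; rewrite ltn_divLR; lia.
have -> : (m.-1 + r.-1)%N = ((m - r) + r.-1 * 2)%N by lia.
rewrite exprD exprM sqrr_sign mulr1.
have -> : m%:Z - 1 = m.-1%:Z by lia.
have -> : r%:Z - 1 = r.-1%:Z by lia.
rewrite binz_nat subn1 /bracket; have -> : m%:Z - 1 = m.-1%:Z by lia.
ring.
Qed.
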